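(* Let $H$ be a complex Hilbert space, let $A,B\in B^{++}(H)$, $n\in\mathbb{N}$ (so $n\ge1$) and $v\in\mathbb{R}$. (i) If $v\notin\left[0,\frac1{2^n}\right]$, then $$A\nabla B\le\hat H_v(A,B)+v\sum_{k=1}^n2^{k-1}\left(A\nabla B-2H_{\frac1{2^k}}(A,B)+H_{\frac1{2^{k-1}}}(A,B)\right).$$ (ii) If $v\notin\left[\frac{2^n-1}{2^n},1\right]$, then $$A\nabla B\le\hat H_v(A,B)+(1-v)\sum_{k=1}^n2^{k-1}\left(A\nabla B-2H_{\frac{2^k-1}{2^k}}(A,B)+H_{\frac{2^{k-1}-1}{2^{k-1}}}(A,B)\right).$$
   Context: $B(H)$ is the algebra of bounded linear operators on the complex Hilbert space $H$. A self-adjoint $T\in B(H)$ is positive, written $T\ge0$, if $\langle Tx,x\rangle\ge0$ for all $x\in H$; $S\le T$ means $T-S\ge0$. $B^{++}(H)$ is the set of positive invertible operators in $B(H)$. For $A,B\in B^{++}(H)$ and $v\in\mathbb{R}$, set $A\natural_v B=A^{1/2}\left(A^{-1/2}BA^{-1/2}\right)^vA^{1/2}$ (real powers via continuous functional calculus) and $\hat H_v(A,B)=\frac{A\natural_v B+A\natural_{1-v}B}{2}$. For $v\in[0,1]$ one writes $A\sharp_v B=A\natural_v B$ and $H_v(A,B)=\frac{A\sharp_v B+A\sharp_{1-v}B}{2}$. Further, $A\nabla B=\frac{A+B}2$. *)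

(* Defs.v *)
From HB Require Import structures.
From mathcomp Require Import all_boot all_order all_algebra.
From mathcomp Require Export complex.
From mathcomp Require Import all_classical all_reals all_analysis.
Import Order.TTheory GRing.Theory Num.Theory.
Import numFieldNormedType.Exports.

Set Implicit Arguments.
Unset Strict Implicit.
Unset Printing Implicit Defensive.

Local Open Scope classical_set_scope.
Local Open Scope ring_scope.
Local Open Scope complex_scope.

(* The norm of a normed module over R[i] takes its (real, nonnegative) values
   in R[i].  [{dot H for Num.conj}] is a positive definite sesquilinear form,
   linear in its first argument and conjugate-linear in the second. *)
HB.mixin Record isHilbert (R : realType) H of CompleteNormedModule R[i] H := {
  inner : {dot H for (@Num.conj R[i])};
  normr_inner : forall x : H, `|x| ^+ 2 = inner x x
}.

#[short(type="hilbertType")]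
HB.structure Definition Hilbert (R : realType) :=
  {H of CompleteNormedModule R[i] H & isHilbert R H}.

Section BoundedOperators.
Context {R : realType} {H : hilbertType R}.

Definition bounded_operator : pred (H -> H) := fun T =>
  `[< linear T /\ exists M : R, forall x, `|T x| <= M%:C * `|x| >].

Lemma bounded_operator_submod_closed : submod_closed bounded_operator.
Proof.
split=> [|a S T /asboolP[linS [M hM]] /asboolP[linT [N hN]]]; apply/asboolP; split.
- by move=> b x y; rewrite /= scaler0 addr0.
- by exists 0 => x; rewrite normr0 mul0r.
- move=> b x y; rewrite /= !fctE linS linT !scalerDr !scalerA [b * a]mulrC.
  by rewrite addrACA.
- have aE : `|a| = (complex.Re `|a|)%:C by rewrite RRe_real ?normr_real.
  exists (complex.Re `|a| * M + N) => x; rewrite /= !fctE.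
  apply: le_trans (ler_normD _ _) _.
  rewrite rmorphD rmorphM/= -aE mulrDl lerD// normrZ -mulrA.
  exact: ler_wpM2l (hM x).
Qed.

HB.instance Definition _ :=
  GRing.isSubmodClosed.Build _ _ bounded_operator
    bounded_operator_submod_closed.

End BoundedOperators.

Record bop (R : realType) (H : hilbertType R) := BOp {
  bop_fun :> H -> H;
  bop_funP : bop_fun \in @bounded_operator R H
}.

Notation "''B' ( H )" := (bop H) (at level 8, format "''B' ( H )") : type_scope.

Section OperatorRing.
Context {R : realType} {H : hilbertType R}.
Implicit Types S T U : 'B(H).

HB.instance Definition _ := [isSub for @bop_fun R H].
HB.instance Definition _ := [Choice of 'B(H) by <:].
HB.instance Definition _ := [SubChoice_isSubLmodule of 'B(H) by <:].

Lemma bop_linear T : linear T.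
Proof. by case: T => T /= /asboolP[]. Qed.

HB.instance Definition _ T :=
  GRing.isLinear.Build R[i] H H _ (bop_fun T) (bop_linear T).

Lemma bop_bounded T : exists M : R, forall x, `|T x| <= M%:C * `|x|.
Proof. by case: T => T /= /asboolP[]. Qed.

Lemma bop_ext S T : S =1 T -> S = T.
Proof. by move=> ST; apply/val_inj/funext. Qed.

Lemma bop0E x : (0 : 'B(H)) x = 0.
Proof. by []. Qed.

Lemma bopDE S T x : (S + T) x = S x + T x.
Proof. by []. Qed.

Lemma bopNE T x : (- T) x = - T x.
Proof. by []. Qed.

Lemma bopZE a T x : (a *: T) x = a *: T x.
Proof. by []. Qed.

Lemma bop_one_subproof : (id : H -> H) \in bounded_operator.
Proof. by apply/asboolP; split=> //; exists 1 => x; rewrite mul1r. Qed.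

Lemma bop_mul_subproof S T : (S \o T : H -> H) \in bounded_operator.
Proof.
apply/asboolP; split=> [a x y|]; first by rewrite /= !linearP.
have [M hM] := bop_bounded S; have [N hN] := bop_bounded T.
exists (`|M| * N) => x /=; apply: le_trans (hM _) _.
rewrite rmorphM/= -mulrA; apply: (@le_trans _ _ (`|M|%:C * `|T x|)).
  by rewrite ler_wpM2r// lecR ler_norm.
by rewrite ler_wpM2l// ler0c.
Qed.

Definition bop_one : 'B(H) := BOp bop_one_subproof.
Definition bop_mul S T : 'B(H) := BOp (bop_mul_subproof S T).

Lemma bop_mulA : associative bop_mul.
Proof. by move=> S T U; apply: bop_ext. Qed.
Lemma bop_mul1l : left_id bop_one bop_mul.
Proof. by move=> T; apply: bop_ext. Qed.
Lemma bop_mul1r : right_id bop_one bop_mul.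
Proof. by move=> T; apply: bop_ext. Qed.
Lemma bop_mulDl : left_distributive bop_mul +%R.
Proof. by move=> S T U; apply: bop_ext. Qed.
Lemma bop_mulDr : right_distributive bop_mul +%R.
Proof.
by move=> S T U; apply: bop_ext => x; exact: (linearD S (T x) (U x)).
Qed.

HB.instance Definition _ := GRing.Zmodule_isPzRing.Build 'B(H)
  bop_mulA bop_mul1l bop_mul1r bop_mulDl bop_mulDr.

Lemma bop1E x : (1 : 'B(H)) x = x. Proof. by []. Qed.

Lemma bopME S T x : (S * T) x = S (T x). Proof. by []. Qed.

End OperatorRing.

Section Operators.
Context {R : realType} {H : hilbertType R}.
Implicit Types A B S T : 'B(H).

Definition invertible T := exists S, S * T = 1 /\ T * S = 1.

Definition is_adjoint T S := forall x y : H, inner (T x) y = inner x (S y).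

Definition self_adjoint T := is_adjoint T T.

(* In R[i], [0 <= z] means that z is real and nonnegative. *)
Definition positive_op T :=
  self_adjoint T /\ forall x : H, 0 <= inner (T x) x.

Definition op_le S T := positive_op (T - S).

Definition Bpp : set 'B(H) := [set T | positive_op T /\ invertible T].

Definition spectrum T : set R[i] := [set z : R[i] | ~ invertible (z *: (1 : 'B(H)) - T)].

Definition opnorm T : R :=
  sup [set complex.Re `|T x| | x in [set x : H | `|x| <= 1]].

Definition poly_op (p : {poly R}) T : 'B(H) :=
  \sum_(i < size p) (p`_i)%:C *: T ^+ i.

(* For T self-adjoint, the spectrum is real, and f(T) is the limit in operator
   norm of p_n(T) for any sequence of real polynomials p_n converging to f
   uniformly on the spectrum. *)
Definition is_cfc (f : R -> R) T S := exists p : nat -> {poly R},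
  {uniform [set t : R | spectrum T t%:C],
     (fun n (t : R) => (p n).[t]) @ \oo --> f} /\
  (fun n => opnorm (poly_op (p n) T - S)) @ \oo --> (0 : R).

(* Only meaningful for T self-adjoint and f continuous on its spectrum; the
   default value 0 is irrelevant then. *)
Definition cfc (f : R -> R) T : 'B(H) := xget 0 [set S | is_cfc f T S].

Definition op_powR T (v : R) : 'B(H) := cfc (fun t => t `^ v) T.

(* Defined for every real v; for v in [0, 1] it is the weighted geometric mean
   of A and B. *)
Definition wgmean (v : R) A B : 'B(H) :=
  op_powR A 2^-1
  * op_powR (op_powR A (- 2^-1) * B * op_powR A (- 2^-1)) v
  * op_powR A 2^-1.

(* Defined for every real v; for v in [0, 1] it is the usual Heinz mean. *)
Definition heinz (v : R) A B : 'B(H) :=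
  2^-1 *: (wgmean v A B + wgmean (1 - v) A B).

Definition amean A B : 'B(H) := 2^-1 *: (A + B).

End Operators.

Arguments Bpp {R} H.

(* Main.v *)
Require Import Defs.
From mathcomp Require Import all_boot all_order all_algebra.
From mathcomp Require Import all_classical all_reals all_analysis.
From mathcomp Require Import ring lra.
Import Order.TTheory GRing.Theory Num.Theory.
Import numFieldNormedType.Exports.
Local Open Scope classical_set_scope.
Local Open Scope ring_scope.
Local Open Scope complex_scope.

Set Implicit Arguments.
Unset Strict Implicit.
Unset Printing Implicit Defensive.

(** Put a = A nabla B and h(u) = H_u(A, B), so that h(0) = h(1) = a and
h(1 - u) = h(u).  The sum telescopes: sum_(k <= n) 2^(k-1) (a - 2 h(2^-k) +
h(2^-(k-1))) = 2^n (a - h(2^-n)) ([telescope_sum]).  With s = 2^-n, part (i) thus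
says h(0) <= h(v) + (v/s) (h(0) - h(s)) for v outside [0, s], which expresses
that a convex function lies above its chord through 0 and s outside [0, s]
([heinz_fun_extrapolate]).  Part (ii) is part (i) at 1 - v.

For numbers t > 0 the function u |-> (t^u + t^(1-u)) / 2 is convex because exp
is.  With C = A^(-1/2) B A^(-1/2), every h(u) is the conjugate by A^(1/2) of the
value at C of that function of t, so the operator inequality follows from the
scalar one by positivity of the functional calculus ([cfc_approx_ge0]) and
stability of positivity under conjugation ([heinz_extrapolate]).

What remains is that the functional calculus of T positive and invertible is
well defined, multiplicative and positive.
- For self-adjoint T and a real polynomial p, the norm of p(T) is at most
  k as soon as |p| <= k on the spectrum ([poly_op_norm_le]).  Indeed p(T)^2 - N^2,
  with N the norm of p(T), is not bounded below.  Factoring p^2 - N^2 over the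
  complex numbers yields a root z such that T - z is not bounded below; such a z
  is real and belongs to the spectrum, and |p(z)| = N.
- Operators close to 1 are invertible (Neumann series, hence completeness of the
  space of operators), which confines the spectrum of T to some [m, M] with
  m > 0 ([Bpp_spectrum]).
- On [m, M] the real powers are Lipschitz, hence uniform limits of Bernstein
  polynomials ([powR_poly_approx]). *)

(** * Bernstein approximation of real powers *)

Section Bernstein.
Context {R : realType}.
Implicit Types (q : {poly R}) (g h : nat -> R) (x : R) (n : nat).

(** The mean of g(k) for k the number of successes in n independent trials of
success probability q; conditioning on one trial gives the recursion, and makes
the moments computable by induction without binomial coefficients. *)
Fixpoint bernstein q n g : {poly R} :=
  if n is m.+1 then q * bernstein q m (fun k => g k.+1) + (1 - q) * bernstein q m g
  else (g 0%N)%:P.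

Lemma bernsteinS q n g x :
  (bernstein q n.+1 g).[x] =
  q.[x] * (bernstein q n (fun k => g k.+1)).[x] + (1 - q.[x]) * (bernstein q n g).[x].
Proof. by rewrite /= !hornerE. Qed.

Lemma bernstein_le q n g h x : 0 <= q.[x] <= 1 -> (forall k, (k <= n)%N -> g k <= h k) ->
  (bernstein q n g).[x] <= (bernstein q n h).[x].
Proof.
move=> /andP[q0 q1]; elim: n g h => [|n IH] g h gh; first by rewrite !hornerE gh.
rewrite !bernsteinS lerD// ler_wpM2l// ?subr_ge0// IH// => k kn.
- exact: gh.
- exact/gh/leqW.
Qed.

Lemma bernstein_affine q n g a b x :
  (bernstein q n (fun k => a * g k + b)).[x] = a * (bernstein q n g).[x] + b.
Proof.
elim: n g => [|n IH] g; first by rewrite !hornerE.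
by rewrite !bernsteinS !IH; ring.
Qed.

(** The shift a is free because the recursion replaces k by k + 1, that is, a by
a + 1.  At a = - n q.[x] it is the variance of the binomial law. *)
Lemma bernstein_variance q n x a :
  (bernstein q n (fun k => (k%:R + a) ^+ 2)).[x] =
  (n%:R * q.[x] + a) ^+ 2 + n%:R * (q.[x] * (1 - q.[x])).
Proof.
elim: n a => [|n IH] a; first by rewrite !hornerE.
rewrite bernsteinS IH.
under [X in bernstein q n X]eq_fun => k do rewrite -addn1 natrD -addrA.
by rewrite IH -addn1 natrD; ring.
Qed.

(** With d = e / L, the inequality 2 d |z| <= z^2 + d^2 bounds the deviation
|f(y) - f(x)| <= L |y - x| by a quadratic polynomial in y, and the mean of a
quadratic only involves the variance, which is of order 1 / n. *)
Lemma lipschitz_poly_approx (f : R -> R) (a b L e : R) :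
  a < b -> 0 < L -> 0 < e ->
  (forall x y, a <= x <= b -> a <= y <= b -> `|f x - f y| <= L * `|x - y|) ->
  exists p : {poly R}, forall x, a <= x <= b -> `|p.[x] - f x| <= e.
Proof.
move=> ab L0 e0 fL.
pose q : {poly R} := (b - a)^-1 *: ('X - a%:P).
have qE x : q.[x] = (x - a) / (b - a) by rewrite /q !hornerE mulrC.
have ba0 : 0 < b - a by rewrite subr_gt0.
pose d := e / L.
have d0 : 0 < d by rewrite divr_gt0.
have [n n0 nd] : exists2 n : nat, (0 < n)%N & (b - a) ^+ 2 / d ^+ 2 <= n%:R.
  exists (Num.bound ((b - a) ^+ 2 / d ^+ 2)).+1 => //.
  rewrite (le_trans (ltW (archi_boundP _)))// ?ler_nat//.
  by rewrite divr_ge0// exprn_ge0// ltW.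
have nR0 : 0 < n%:R :> R by rewrite ltr0n.
pose pt k : R := a + (b - a) * (k%:R / n%:R).
exists (bernstein q n (fun k => f (pt k))) => x xab.
have q01 : 0 <= q.[x] <= 1.
  move: xab => /andP[ax xb].
  by rewrite qE divr_ge0 ?subr_ge0 ?(ltW ab)//= ler_pdivrMr// mul1r lerD2r.
have pt_ab k : (k <= n)%N -> a <= pt k <= b.
  move=> kn; rewrite /pt.
  have u0 : 0 <= (k%:R / n%:R : R) by rewrite divr_ge0.
  have u1 : (k%:R / n%:R : R) <= 1 by rewrite ler_pdivrMr// mul1r ler_nat.
  move: (k%:R / n%:R) u0 u1 => u u0 u1.
  by apply/andP; split; nra.
have dev k : (k <= n)%N ->
    `|f (pt k) - f x| <= L * (b - a) ^+ 2 / (2 * d * n%:R ^+ 2)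
                         * (k%:R + - (n%:R * q.[x])) ^+ 2 + L * d / 2.
  move=> kn; apply: (le_trans (fL _ _ (pt_ab _ kn) xab)).
  have -> : L * (b - a) ^+ 2 / (2 * d * n%:R ^+ 2) * (k%:R + - (n%:R * q.[x])) ^+ 2
     + L * d / 2 = L * ((pt k - x) ^+ 2 / (2 * d) + d / 2).
    rewrite qE /pt; field.
    by rewrite !gt_eqF// ?andbT.
  rewrite ler_pM2l// -subr_ge0.
  rewrite -(real_normK (num_real (pt k - x))).
  have -> : `|pt k - x| ^+ 2 / (2 * d) + d / 2 - `|pt k - x|
    = (`|pt k - x| - d) ^+ 2 / (2 * d) by field; rewrite gt_eqF.
  by rewrite divr_ge0 ?sqr_ge0// mulr_ge0// ltW.
have mean : (bernstein q n (fun k => L * (b - a) ^+ 2 / (2 * d * n%:R ^+ 2)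
                         * (k%:R + - (n%:R * q.[x])) ^+ 2 + L * d / 2)).[x] <= e.
  rewrite bernstein_affine bernstein_variance subrr expr0n/= add0r.
  have -> : e = L * d / 2 + L * d / 2 by rewrite /d; field; rewrite gt_eqF.
  rewrite lerD2r.
  have -> : L * (b - a) ^+ 2 / (2 * d * n%:R ^+ 2) * (n%:R * (q.[x] * (1 - q.[x])))
    = L * d / 2 * (q.[x] * (1 - q.[x])) * ((b - a) ^+ 2 / d ^+ 2 / n%:R).
    by field; rewrite !gt_eqF.
  have Ld0 : 0 <= L * d / 2 by rewrite divr_ge0// mulr_ge0// ltW.
  have /andP[q0 q1] := q01.
  have qq0 : 0 <= q.[x] * (1 - q.[x]) by rewrite mulr_ge0// subr_ge0.
  have qq1 : q.[x] * (1 - q.[x]) <= 1 by nra.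
  rewrite -[leRHS]mulr1 ler_pM//.
  - by rewrite mulr_ge0.
  - by rewrite !divr_ge0// exprn_ge0// ltW.
  - by rewrite -[leRHS]mulr1 ler_wpM2l.
  - by rewrite ler_pdivrMr// mul1r.
have shift : (bernstein q n (fun k => f (pt k))).[x] - f x =
    (bernstein q n (fun k => 1 * f (pt k) - f x)).[x].
  by rewrite bernstein_affine mul1r.
rewrite shift ler_norml; apply/andP; split.
- rewrite lerNl; apply: le_trans mean.
  have -> : - (bernstein q n (fun k => 1 * f (pt k) - f x)).[x] =
     (bernstein q n (fun k => (-1) * f (pt k) + f x)).[x].
    by rewrite !bernstein_affine; ring.
  apply: bernstein_le => // k /dev; apply: le_trans.
  by rewrite mulN1r addrC distrC ler_norm.
- apply: le_trans mean; apply: bernstein_le => // k /dev; apply: le_trans.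
  by rewrite mul1r ler_norm.
Qed.

Lemma powR_lipschitz (m M v : R) : 0 < m -> m < M ->
  exists2 L, 0 < L & forall x y, m <= x <= M -> m <= y <= M ->
    `|x `^ v - y `^ v| <= L * `|x - y|.
Proof.
move=> m0 mM; pose L := `|v| * (m `^ (v - 1) + M `^ (v - 1)) + 1.
exists L; first by rewrite ltr_wpDl// mulr_ge0// addr_ge0// powR_ge0.
have bound c : m <= c <= M -> `|v * c `^ (v - 1)| <= L.
  move=> /andP[mc cM]; have c0 : 0 < c by apply: lt_le_trans mc.
  rewrite normrM ler_wpDr// ler_wpM2l// ger0_norm ?powR_ge0//.
  have [v1|v1] := leP 1 v.
    rewrite ler_wpDl ?powR_ge0//; apply: ge0_ler_powR => //.
    - by rewrite subr_ge0.
    - by rewrite nnegrE ltW.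
    - by rewrite nnegrE ltW// (lt_le_trans c0).
  rewrite ler_wpDr ?powR_ge0//.
  rewrite -opprB !powRN lef_pV2 ?posrE ?powR_gt0//.
  apply: ge0_ler_powR => //.
  - by rewrite subr_ge0 ltW.
  - by rewrite nnegrE ltW.
  - by rewrite nnegrE ltW.
have main x y : m <= x -> x <= y -> y <= M -> `|y `^ v - x `^ v| <= L * `|y - x|.
  move=> mx xy yM.
  have pos z : x <= z -> 0 < z by move=> xz; exact/(lt_le_trans m0)/(le_trans mx).
  have [||c] := @MVT_segment _ (fun t => t `^ v) (fun t => v * t `^ (v - 1)) x y xy.
  - move=> z; rewrite in_itv/= => /andP[xz _]; apply: is_derive1_powR.
    exact/pos/ltW.
  - apply: derivable_within_continuous => z; rewrite in_itv/= => /andP[xz _].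
    by apply: derivable_powR; rewrite in_itv/= andbT; exact: pos.
  - rewrite in_itv/= => /andP[xc cy] ->.
    by rewrite normrM ler_wpM2r// bound// (le_trans mx)//= (le_trans cy).
move=> x y /andP[mx xM] /andP[my yM]; have [xy|/ltW yx] := leP x y.
  by rewrite distrC [`|x - y|]distrC main.
exact: main.
Qed.

Lemma powR_poly_approx (m M v e : R) : 0 < m -> m < M -> 0 < e ->
  exists p : {poly R}, forall x, m <= x <= M -> `|p.[x] - x `^ v| <= e.
Proof.
move=> m0 mM e0; have [L L0 fL] := powR_lipschitz v m0 mM.
exact: (lipschitz_poly_approx mM L0 e0 fL).
Qed.

End Bernstein.

(** * Real inner product, positive operators and norm bounds *)

Section RealInner.
Context {R : realType} {H : hilbertType R}.
Implicit Types (x y z : H) (S T : 'B(H)).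

Definition rnorm x : R := complex.Re `|x|.
Definition rinner x y : R := complex.Re (inner x y).

Lemma normr_rnorm x : `|x| = (rnorm x)%:C.
Proof. by rewrite /rnorm RRe_real ?normr_real. Qed.

Lemma normr_le1 x : (`|x| <= 1) = (rnorm x <= 1).
Proof. by rewrite normr_rnorm (lecR _ 1). Qed.

Lemma rnorm_ge0 x : 0 <= rnorm x.
Proof. by rewrite -ler0c -normr_rnorm. Qed.

Lemma rnorm0 : rnorm (0 : H) = 0.
Proof. by rewrite /rnorm normr0. Qed.

Lemma rnorm_eq0 x : (rnorm x == 0) = (x == 0).
Proof. by rewrite -(normr_eq0 x) normr_rnorm -(inj_eq (@complexI R)). Qed.

Lemma rnormD x y : rnorm (x + y) <= rnorm x + rnorm y.
Proof. by rewrite -lecR rmorphD/= -!normr_rnorm ler_normD. Qed.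

Lemma rnormN x : rnorm (- x) = rnorm x.
Proof. by rewrite /rnorm normrN. Qed.

Lemma rnormZ (a : R) x : rnorm (a%:C *: x) = `|a| * rnorm x.
Proof.
by rewrite {1}/rnorm normrZ normr_rnorm normc_def/= expr0n/= addr0 sqrtr_sqr mulr0 subr0.
Qed.

Lemma rinnerxx x : rinner x x = rnorm x ^+ 2.
Proof. by rewrite /rinner -normr_inner normr_rnorm -rmorphXn. Qed.

Lemma innerC x y : inner y x = (inner x y)^*%C.
Proof. by rewrite (hermC (@inner R H)) expr0 mul1r. Qed.

Lemma ReD (a b : R[i]) : complex.Re (a + b) = complex.Re a + complex.Re b.
Proof. by case: a b => ? ? []. Qed.

Lemma ReZ (a : R) (b : R[i]) : complex.Re (a%:C * b) = a * complex.Re b.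
Proof. by case: b => ? ? /=; rewrite mul0r subr0. Qed.

Lemma Im_ReI (b : R[i]) : complex.Im b = - complex.Re ('i * b).
Proof. by case: b => ? ? /=; ring. Qed.

Lemma Re_conj (b : R[i]) : complex.Re b^*%C = complex.Re b.
Proof. by case: b. Qed.

Lemma Im_conj (b : R[i]) : complex.Im b^*%C = - complex.Im b.
Proof. by case: b. Qed.

Lemma rinnerC x y : rinner x y = rinner y x.
Proof. by rewrite /rinner innerC Re_conj. Qed.

Lemma rinnerDl x y z : rinner (x + y) z = rinner x z + rinner y z.
Proof. by rewrite /rinner linearDl ReD. Qed.

Lemma rinnerDr x y z : rinner x (y + z) = rinner x y + rinner x z.
Proof. by rewrite !(rinnerC x) rinnerDl. Qed.

Lemma rinnerZl (a : R) x y : rinner (a%:C *: x) y = a * rinner x y.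
Proof. by rewrite /rinner linearZl_LR ReZ. Qed.

Lemma rinnerZr (a : R) x y : rinner x (a%:C *: y) = a * rinner x y.
Proof. by rewrite !(rinnerC x) rinnerZl. Qed.

Lemma rinnerNl x y : rinner (- x) y = - rinner x y.
Proof. by rewrite -scaleN1r -(rmorphN1 (real_complex R)) rinnerZl mulN1r. Qed.

Lemma rinnerNr x y : rinner x (- y) = - rinner x y.
Proof. by rewrite !(rinnerC x) rinnerNl. Qed.

(** The real part of the inner product determines the inner product, so that
identities and limits can be checked on real numbers. *)
Lemma inner_imag x y : complex.Im (inner x y) = - rinner ('i *: x) y.
Proof. by rewrite Im_ReI /rinner linearZl_LR. Qed.

Lemma rnorm_sqrD x y :
  rnorm (x + y) ^+ 2 = rnorm x ^+ 2 + 2 * rinner x y + rnorm y ^+ 2.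
Proof.
by rewrite -!rinnerxx rinnerDl !rinnerDr (rinnerC y x); ring.
Qed.

(** Cauchy-Schwarz, read off the triangle inequality by squaring it. *)
Lemma rinner_le x y : rinner x y <= rnorm x * rnorm y.
Proof.
have := rnormD x y; rewrite -(ler_pXn2r (n := 2)) ?nnegrE ?addr_ge0 ?rnorm_ge0//.
by rewrite rnorm_sqrD; lra.
Qed.

Lemma normr_rinner x y : `|rinner x y| <= rnorm x * rnorm y.
Proof. by rewrite ler_norml lerNl -rinnerNl -{1}(rnormN x) !rinner_le. Qed.

Lemma self_adjointP T :
  self_adjoint T <-> (forall x y, rinner (T x) y = rinner x (T y)).
Proof.
split=> [sT x y|sT x y]; first by rewrite /rinner sT.
apply/eqP; rewrite eq_complex; apply/andP; split; apply/eqP; first exact: sT.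
by rewrite !inner_imag -linearZ sT.
Qed.

Lemma self_adjoint_real T x : self_adjoint T -> complex.Im (inner (T x) x) = 0.
Proof.
move=> sT; have : inner (T x) x = (inner (T x) x)^*%C by rewrite -innerC sT.
by move=> /(congr1 (@complex.Im R)); rewrite Im_conj; lra.
Qed.

Lemma positive_opP T :
  positive_op T <-> self_adjoint T /\ (forall x, 0 <= rinner (T x) x).
Proof.
split=> -[sT pT]; split=> // x.
  by have := pT x; rewrite lecE => /andP[].
by rewrite lecE pT andbT self_adjoint_real.
Qed.

(** The inequality opnorm T <= k in pointwise form. *)
Definition norm_le T (k : R) := forall x, rnorm (T x) <= k * rnorm x.

Lemma bop_norm_le T : exists2 k, 0 < k & norm_le T k.
Proof.
have [M hM] := bop_bounded T; exists (`|M| + 1) => [|x].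
  exact: ltr_wpDl.
have := hM x; rewrite !normr_rnorm -rmorphM/= lecR => /le_trans; apply.
by rewrite ler_wpM2r ?rnorm_ge0// ler_wpDr// ler_norm.
Qed.

Lemma opnorm_has_ubound T :
  has_ubound [set complex.Re `|T x| | x in [set x : H | `|x| <= 1]].
Proof.
have [M M0 hM] := bop_norm_le T.
exists M => _ [x /= x1 <-]; apply: (le_trans (hM x)).
rewrite -[leRHS]mulr1 ler_wpM2l ?(ltW M0)//.
by rewrite -normr_le1.
Qed.

Lemma opnorm_ge0 T : 0 <= opnorm T.
Proof.
apply: (ub_le_sup (opnorm_has_ubound T)); exists 0; rewrite /= ?normr0 ?ler01//.
by rewrite linear0 normr0.
Qed.

Lemma opnorm_norm_le T : norm_le T (opnorm T).
Proof.
move=> x; have [->|x0] := eqVneq x 0.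
  by rewrite linear0 rnorm0 mulr0.
have nx : 0 < rnorm x by rewrite lt_def rnorm_eq0 x0 rnorm_ge0.
have -> : x = (rnorm x)%:C *: ((rnorm x)^-1%:C *: x).
  by rewrite scalerA -rmorphM/= divff ?gt_eqF// scale1r.
set u := _^-1%:C *: x.
have u1 : rnorm u = 1.
  by rewrite rnormZ ger0_norm ?invr_ge0 ?rnorm_ge0// mulVf// gt_eqF.
rewrite linearZ !(rnormZ (rnorm x)) ger0_norm ?rnorm_ge0// u1 mulr1 mulrC ler_wpM2r ?rnorm_ge0//.
by apply: (ub_le_sup (opnorm_has_ubound T)); exists u => //=; rewrite normr_rnorm u1.
Qed.

Lemma opnorm_le T (k : R) : norm_le T k -> 0 <= k -> opnorm T <= k.
Proof.
move=> Tk k0; apply: ge_sup.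
  by exists (complex.Re `|T 0|), 0 => //=; rewrite normr0.
move=> _ [x /= x1 <-]; apply: (le_trans (Tk x)).
rewrite -[leRHS]mulr1 ler_wpM2l//.
by rewrite -normr_le1.
Qed.

Lemma norm_leM S T k l : 0 <= k -> norm_le S k -> norm_le T l -> norm_le (S * T) (k * l).
Proof.
move=> k0 hS hT x; rewrite bopME (le_trans (hS _))// -mulrA.
by rewrite ler_wpM2l.
Qed.

Lemma norm_leD S T k l : norm_le S k -> norm_le T l -> norm_le (S + T) (k + l).
Proof. by move=> hS hT x; rewrite bopDE (le_trans (rnormD _ _))// mulrDl lerD. Qed.

Lemma norm_leZ (a : R) T k : norm_le T k -> norm_le (a%:C *: T) (`|a| * k).
Proof. by move=> hT x; rewrite bopZE rnormZ -mulrA ler_wpM2l. Qed.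

Lemma norm_leN T k : norm_le T k -> norm_le (- T) k.
Proof. by move=> hT x; rewrite bopNE rnormN. Qed.

Lemma norm_leW T k l : k <= l -> norm_le T k -> norm_le T l.
Proof. by move=> kl hT x; rewrite (le_trans (hT x))// ler_wpM2r ?rnorm_ge0. Qed.

Lemma norm_le0 T : (forall e, 0 < e -> norm_le T e) -> T = 0.
Proof.
move=> T0; apply: bop_ext => x; apply/eqP; rewrite -rnorm_eq0 eq_le rnorm_ge0 andbT.
apply/ler_addgt0Pl => e e0; rewrite addr0.
have x1 : 0 < rnorm x + 1 by rewrite ltr_wpDl ?rnorm_ge0.
apply: (le_trans (T0 (e / (rnorm x + 1)) _ x)); first by rewrite divr_gt0.
by rewrite mulrAC ler_pdivrMr// ler_wpM2l ?ltW// ltrDl.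
Qed.

(** The form <T y, y> is nonnegative at y = x - k^-1 T x; expanding it there and
bounding <T (T x), T x> by the hypothesis gives the inequality. *)
Lemma positive_op_sqr_le T k : 0 < k -> positive_op T ->
  (forall x, rinner (T x) x <= k * rnorm x ^+ 2) ->
  forall x, rnorm (T x) ^+ 2 <= k * rinner (T x) x.
Proof.
move=> k0 /positive_opP[/self_adjointP sT pT] Tk x.
have := pT (x + (- k^-1)%:C *: T x).
rewrite linearD linearZ /= rinnerDl !rinnerDr !rinnerZr !rinnerZl.
rewrite (sT (T x) x) rinnerxx => le0.
have TT := Tk (T x).
rewrite -ler_pdivrMl//.
have kk : 0 < k^-1 by rewrite invr_gt0.
have : k^-1 ^+ 2 * rinner (T (T x)) (T x) <= k^-1 * rnorm (T x) ^+ 2.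
  by rewrite expr2 -!mulrA ler_wpM2l ?(ltW kk)// ler_pdivrMl.
by lra.
Qed.

Lemma positive_op_norm_le T k : 0 <= k -> positive_op T ->
  (forall x, rinner (T x) x <= k * rnorm x ^+ 2) -> norm_le T k.
Proof.
move=> k0 pT Tk.
have Tk' l : k < l -> norm_le T l.
  move=> kl x; have l0 : 0 < l by apply: le_lt_trans kl.
  have Tl z : rinner (T z) z <= l * rnorm z ^+ 2.
    by rewrite (le_trans (Tk z))// ler_wpM2r ?sqr_ge0// ltW.
  rewrite -(ler_pXn2r (n := 2)) ?nnegrE ?mulr_ge0 ?rnorm_ge0 ?(ltW l0)//.
  rewrite (le_trans (positive_op_sqr_le l0 pT Tl x))// exprMn expr2 -mulrA.
  by rewrite ler_wpM2l// ltW.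
move=> x; have [->|x0] := eqVneq x 0; first by rewrite linear0 rnorm0 mulr0.
have nx : 0 < rnorm x by rewrite lt_def rnorm_eq0 x0 rnorm_ge0.
rewrite -ler_pdivrMr//; apply/ler_addgt0Pr => e e0.
by rewrite ler_pdivrMr// Tk'// ltrDl.
Qed.

End RealInner.

(** * Completeness of the space of operators *)

Section Completeness.
Context {R : realType} {H : hilbertType R}.
Implicit Types (x y z : H) (S T : 'B(H)).

Lemma hilbert_complete (u : nat -> H) :
  (forall e : R, 0 < e -> exists N, forall n m, (N <= n)%N -> (N <= m)%N ->
     rnorm (u n - u m) <= e) ->
  exists l, forall e : R, 0 < e -> exists N, forall n, (N <= n)%N -> rnorm (u n - l) <= e.
Proof.
move=> uC.
have real_pos (e : R[i]) : 0 < e -> exists2 e', e = e'%:C & 0 < e'.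
  move=> e0; exists (complex.Re e); first by rewrite RRe_real// gtr0_real.
  by move: e0; rewrite ltcE => /andP[].
have : cvg (u @ \oo).
  apply/cauchy_cvgP/cauchy_exP => _ /real_pos[e -> e0].
  have [|N uN] := uC (e / 2); first by rewrite divr_gt0.
  exists (u N); exists N => // n /= Nn.
  rewrite -ball_normE/= normr_rnorm ltcR; apply: le_lt_trans (uN _ _ _ Nn) _ => //.
  by rewrite ltr_pdivrMr// ltr_pMr// ltr1n.
move=> /cvg_ex[l ul]; exists l => e e0.
have /cvgrPdist_le/(_ e%:C) := ul; rewrite ltcR => /(_ e0) [N _ uN].
exists N => n Nn; have := uN n Nn.
by rewrite /= normr_rnorm lecR -rnormN opprB.
Qed.

Lemma rnorm_closed x (k : R) :
  (forall e, 0 < e -> exists y, rnorm (x - y) <= e /\ rnorm y <= k + e) -> rnorm x <= k.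
Proof.
move=> xk; apply/ler_addgt0Pl => e e0.
have [|y [xy yk]] := xk (e / 2); first by rewrite divr_gt0.
have := rnormD (x - y) y; rewrite subrK; lra.
Qed.

Lemma bop_complete (S : nat -> 'B(H)) :
  (forall e : R, 0 < e -> exists N, forall n m, (N <= n)%N -> (N <= m)%N ->
     norm_le (S n - S m) e) ->
  exists T, forall e : R, 0 < e -> exists N, forall n, (N <= n)%N -> norm_le (S n - T) e.
Proof.
move=> SC.
have /choice[L SL] : forall x, exists l, forall e : R, 0 < e ->
    exists N, forall n, (N <= n)%N -> rnorm (S n x - l) <= e.
  move=> x; apply: hilbert_complete => e e0.
  have x1 : 0 < rnorm x + 1 by rewrite ltr_wpDl ?rnorm_ge0.
  have [|N SN] := SC (e / (rnorm x + 1)); first by rewrite divr_gt0.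
  exists N => n m Nn Nm; apply: (le_trans (SN _ _ Nn Nm x)).
  by rewrite mulrAC ler_pdivrMr// ler_wpM2l ?ltW// ltrDl.
have unif (e : R) : 0 < e -> exists N, forall n x, (N <= n)%N -> rnorm (S n x - L x) <= e * rnorm x.
  move=> e0; have [N SN] := SC _ e0; exists N => n x Nn.
  apply: rnorm_closed => d d0; have [M SM] := SL x _ d0.
  exists (S n x - S (maxn N M) x); split.
    by rewrite opprB addrC addrA subrK SM// leq_maxr.
  have := SN n (maxn N M) Nn (leq_maxl _ _) x; rewrite bopDE bopNE; lra.
have linL : linear L.
  move=> a x y; apply/eqP; rewrite -subr_eq0 -rnorm_eq0 eq_le rnorm_ge0 andbT.
  pose k := rnorm (a *: x + y) + complex.Re `|a| * rnorm x + rnorm y + 1.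
  have a0 : 0 <= complex.Re `|a| by have := normr_ge0 a; rewrite lecE => /andP[].
  have k0 : 0 < k.
    by rewrite /k ltr_wpDl// !addr_ge0 ?rnorm_ge0// mulr_ge0// rnorm_ge0.
  apply/ler_addgt0Pl => e e0; rewrite addr0.
  have [|N SN] := unif (e / k); first by rewrite divr_gt0.
  have -> : L (a *: x + y) - (a *: L x + L y) =
     - (S N (a *: x + y) - L (a *: x + y)) + a *: (S N x - L x) + (S N y - L y).
    rewrite (linearP (S N)) scalerBr opprB -[RHS]addrA.
    by rewrite [X in _ = _ + X]addrACA -opprD addrA subrK.
  apply: (@le_trans _ _ (e / k * k)); last by rewrite divfK ?gt_eqF.
  have hZ z : rnorm (a *: z) = complex.Re `|a| * rnorm z.
    by rewrite /rnorm normrZ -{1}(RRe_real (normr_real a)) ReZ.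
  apply: (@le_trans _ _ (e / k * rnorm (a *: x + y) + complex.Re `|a| * (e / k * rnorm x)
      + e / k * rnorm y)).
    apply: (le_trans (rnormD _ _)); rewrite lerD// ?SN//.
    apply: (le_trans (rnormD _ _)); rewrite rnormN hZ lerD// ?SN//.
    by rewrite ler_wpM2l// SN.
  have ek : 0 < e / k by rewrite divr_gt0.
  by move: (e / k) ek => d d0; rewrite /k; lra.
have bL : L \in bounded_operator.
  apply/asboolP; split => //.
  have [N SN] := unif 1 ltr01; have [K K0 SK] := bop_norm_le (S N).
  exists (1 + K) => x; rewrite !normr_rnorm -rmorphM/= lecR.
  have -> : L x = - (S N x - L x) + S N x by rewrite opprB subrK.
  by rewrite (le_trans (rnormD _ _))// rnormN mulrDl lerD// SN.
exists (BOp bL) => e e0; have [N SN] := unif e e0.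
by exists N => n Nn x; exact: SN.
Qed.
End Completeness.

(** * Neumann series and coercive operators *)

Section Invertibility.
Context {R : realType} {H : hilbertType R}.
Implicit Types (x y z : H) (S T K : 'B(H)).

Lemma bop_scalerAl (a : R[i]) S T : a *: (S * T) = (a *: S) * T.
Proof. exact: bop_ext. Qed.

Lemma bop_scalerAr (a : R[i]) S T : a *: (S * T) = S * (a *: T).
Proof. by apply: bop_ext => x; rewrite bopZE !bopME bopZE linearZ. Qed.

Lemma invertibleZ (a : R[i]) T : invertible (a *: T) -> invertible T.
Proof.
move=> [S [ST TS]]; exists (a *: S); split.
  by rewrite -bop_scalerAl bop_scalerAr.
by rewrite -bop_scalerAr bop_scalerAl.
Qed.

Lemma invertibleN T : invertible T -> invertible (- T).
Proof. by move=> [S [ST TS]]; exists (- S); rewrite !mulrNN. Qed.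

Lemma invertibleM S T : invertible S -> invertible T -> invertible (S * T).
Proof.
move=> [S' [lS rS]] [T' [lT rT]]; exists (T' * S'); split.
  by rewrite mulrA -(mulrA T') lS mulr1.
by rewrite mulrA -(mulrA S) rT mulr1.
Qed.

Lemma norm_leX K (k : R) n : 0 <= k -> norm_le K k -> norm_le (K ^+ n) (k ^+ n).
Proof.
move=> k0 Kk; elim: n => [|n IH]; first by move=> x; rewrite !expr0 mul1r.
by rewrite !exprS; apply: norm_leM.
Qed.

(** The partial sums S(n) of the Neumann series satisfy S(n+1) = 1 + K S(n) =
1 + S(n) K, and both identities pass to the limit. *)
Lemma neumann K (k : R) : 0 <= k -> k < 1 -> norm_le K k -> invertible (1 - K).
Proof.
move=> k0 k1 Kk; pose S n := iter n (fun X => 1 + K * X) 0 : 'B(H).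
have SS n : S n.+1 = 1 + K * S n by [].
have SC n : S n * K = K * S n.
  elim: n => [|n IH]; first by rewrite mul0r mulr0.
  by rewrite !SS mulrDl mulrDr mul1r mulr1 -mulrA IH.
have SD n d : S (n + d)%N = S n + K ^+ n * S d.
  elim: n => [|n IH]; first by rewrite expr0 mul1r add0r.
  by rewrite addSn !SS IH mulrDr addrA mulrA -exprS.
have k1' : 0 < 1 - k by rewrite subr_gt0.
have Sk n : norm_le (S n) (1 - k)^-1.
  elim: n => [|n IH] x; first by rewrite bop0E rnorm0 mulr_ge0 ?rnorm_ge0// invr_ge0 ltW.
  rewrite SS bopDE (le_trans (rnormD _ _))// bop1E.
  have -> : (1 - k)^-1 * rnorm x = rnorm x + k * (1 - k)^-1 * rnorm x.
    by field; rewrite gt_eqF.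
  by rewrite lerD2l; apply: norm_leM.
have [|T ST] := @bop_complete _ _ S.
  move=> e e0; have : (fun n => k ^+ n) @ \oo --> (0 : R) by apply: cvg_expr; rewrite ger0_norm.
  have e0' : 0 < e * (1 - k) by rewrite mulr_gt0.
  move=> /cvgrPdist_le/(_ _ e0')[N _ kN]; exists N.
  have le n m : (N <= n)%N -> (n <= m)%N -> norm_le (S m - S n) e.
    move=> Nn nm; rewrite -(subnKC nm) SD addrAC subrr add0r.
    apply: (norm_leW (k := k ^+ n * (1 - k)^-1)); last first.
      by apply: norm_leM => //; [exact: exprn_ge0|exact: norm_leX].
    by rewrite ler_pdivrMr// (le_trans _ (kN n Nn))//= sub0r normrN ler_norm.
  move=> n m Nn Nm; have [nm|/ltnW mn] := leqP n m; last exact: le.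
  by rewrite -opprB; apply/norm_leN/le.
have fixT : T = 1 + K * T.
  apply/eqP; rewrite -subr_eq0; apply/eqP/norm_le0 => e e0.
  have [|N SN] := ST (e / (1 + k)); first by rewrite divr_gt0// ltr_wpDr.
  have -> : T - (1 + K * T) = - (S N.+1 - T) + K * (S N - T).
    rewrite SS mulrBr opprB -[RHS]addrA; congr (_ + _).
    by rewrite !opprD addrA subrK.
  apply: (norm_leW (k := e / (1 + k) + k * (e / (1 + k)))).
    by rewrite -{1}[e / _]mul1r -mulrDl mulrC divfK// gt_eqF// ltr_wpDr.
  by apply: norm_leD; [exact/norm_leN/SN|apply: norm_leM => //; exact: SN].
have TK : T * K = K * T.
  apply/eqP; rewrite -subr_eq0; apply/eqP/norm_le0 => e e0.
  have [|N SN] := ST (e / (k + k + 1)); first by rewrite divr_gt0// ltr_wpDl// addr_ge0.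
  have -> : T * K - K * T = - ((S N - T) * K) + K * (S N - T).
    by rewrite mulrBl mulrBr SC opprB addrA subrK.
  apply: (norm_leW (k := e / (k + k + 1) * k + k * (e / (k + k + 1)))).
    rewrite [_ * k]mulrC -mulrDl mulrA ler_pdivrMr ?ltr_wpDl ?addr_ge0//.
    by rewrite mulrC ler_wpM2l ?(ltW e0)// lerDl.
  apply: norm_leD; last by apply: norm_leM => //; exact: SN.
  apply: norm_leN; apply: norm_leM => //; last exact: SN.
  by rewrite divr_ge0 ?(ltW e0)// !addr_ge0.
exists T; split.
  by rewrite mulrBr mulr1 TK {1}fixT addrK.
by rewrite mulrBl mul1r {1}fixT addrK.
Qed.

Lemma self_adjoint1 : self_adjoint (1 : 'B(H)).
Proof. by []. Qed.

Lemma self_adjointD S T : self_adjoint S -> self_adjoint T -> self_adjoint (S + T).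
Proof.
move=> /self_adjointP sS /self_adjointP sT; apply/self_adjointP => x y.
by rewrite !bopDE rinnerDl rinnerDr sS sT.
Qed.

Lemma self_adjointZ (a : R) T : self_adjoint T -> self_adjoint (a%:C *: T).
Proof.
move=> /self_adjointP sT; apply/self_adjointP => x y.
by rewrite !bopZE rinnerZl rinnerZr sT.
Qed.

Lemma self_adjointN T : self_adjoint T -> self_adjoint (- T).
Proof.
move=> /self_adjointP sT; apply/self_adjointP => x y.
by rewrite !bopNE rinnerNl rinnerNr sT.
Qed.

(** For c a bound on T, the operator K = 1 - T / (c + d) satisfies
0 <= K <= 1 - d / (c + d) < 1, so T = (c + d) (1 - K) is inverted by a Neumann
series. *)
Lemma coercive_invertible T (d : R) : self_adjoint T -> 0 < d ->
  (forall x, d * rnorm x ^+ 2 <= rinner (T x) x) -> invertible T.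
Proof.
move=> sT d0 dT; have [c c0 Tc] := bop_norm_le T.
have cd0 : 0 < c + d by rewrite addr_gt0.
pose K := 1 - ((c + d)^-1)%:C *: T.
have KE x : rinner (K x) x = rnorm x ^+ 2 - (c + d)^-1 * rinner (T x) x.
  by rewrite /K bopDE bopNE bopZE bop1E rinnerDl rinnerNl rinnerZl rinnerxx.
have -> : T = (c + d)%:C *: (1 - K).
  rewrite /K subKr scalerA -rmorphM/= divff ?gt_eqF//.
  by rewrite scale1r.
have K1 : norm_le K (1 - d / (c + d)).
  have k0 : 0 <= 1 - d / (c + d).
    by rewrite subr_ge0 ler_pdivrMr// mul1r lerDr ltW.
  apply: positive_op_norm_le => //.
    apply/positive_opP; split.
      exact/self_adjointD/self_adjointN/self_adjointZ.
    move=> x; rewrite KE subr_ge0 ler_pdivrMl//.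
    have := rinner_le (T x) x; have := Tc x; have := rnorm_ge0 x.
    by move: (rnorm x) (rnorm (T x)) => u w; nra.
  move=> x; rewrite KE mulrBl mul1r lerD2l lerN2.
  by rewrite mulrAC mulrC ler_wpM2l// invr_ge0 ltW.
apply: (@invertibleZ ((c + d)^-1)%:C).
rewrite scalerA -rmorphM/= mulVf ?gt_eqF// scale1r.
apply: neumann K1; first by rewrite subr_ge0 ler_pdivrMr// mul1r lerDr ltW.
by rewrite ltrBlDr ltrDl divr_gt0.
Qed.

End Invertibility.

(** * Polynomials in a self-adjoint operator *)

Section PolynomialCalculus.
Context {R : realType} {H : hilbertType R}.
Implicit Types (x y : H) (S T : 'B(H)) (p q : {poly R[i]}).

(** Complex coefficients are needed to split real polynomials into linear
factors. *)
Definition cpoly_op p T : 'B(H) := \sum_(i < size p) p`_i *: T ^+ i.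

Lemma cpoly_op_wide p T n : (size p <= n)%N ->
  cpoly_op p T = \sum_(i < n) p`_i *: T ^+ i.
Proof.
move=> pn; rewrite /cpoly_op (big_ord_widen _ (fun i => p`_i *: T ^+ i) pn) big_mkcond.
by apply: eq_bigr => i _; case: ltnP => // pi; rewrite nth_default// scale0r.
Qed.

Lemma cpoly_opD p q T : cpoly_op (p + q) T = cpoly_op p T + cpoly_op q T.
Proof.
pose n := maxn (size p) (size q).
rewrite (@cpoly_op_wide (p + q) _ n) ?size_polyD//.
rewrite (@cpoly_op_wide p _ n) ?leq_maxl// (@cpoly_op_wide q _ n) ?leq_maxr//.
by rewrite -big_split; apply: eq_bigr => i _; rewrite coefD scalerDl.
Qed.

Lemma cpoly_opZ a p T : cpoly_op (a *: p) T = a *: cpoly_op p T.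
Proof.
rewrite (@cpoly_op_wide (a *: p) _ (size p)) ?size_scale_leq// scaler_sumr.
by apply: eq_bigr => i _; rewrite coefZ scalerA.
Qed.

Lemma cpoly_opC a T : cpoly_op a%:P T = a *: (1 : 'B(H)).
Proof.
rewrite (@cpoly_op_wide _ _ 1) ?size_polyC_leq1// big_ord1 coefC.
by rewrite eqxx expr0.
Qed.

Lemma cpoly_opMX p T : cpoly_op (p * 'X) T = cpoly_op p T * T.
Proof.
rewrite (@cpoly_op_wide _ _ (size p).+1); last first.
  by rewrite (leq_trans (size_polyMleq _ _))// size_polyX addn2.
rewrite big_ord_recl coefMX eqxx scale0r add0r mulr_suml.
by apply: eq_bigr => i _; rewrite coefMX /= -bop_scalerAl -exprSr.
Qed.

Lemma cpoly_opX T : cpoly_op 'X T = T.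
Proof. by rewrite -['X]mul1r cpoly_opMX cpoly_opC scale1r mul1r. Qed.

Lemma cpoly_opM p q T : cpoly_op (p * q) T = cpoly_op p T * cpoly_op q T.
Proof.
elim/poly_ind: q => [|q c IH].
  by rewrite mulr0 -!(polyC0 R[i]) !cpoly_opC scale0r mulr0.
rewrite mulrDr mulrA !cpoly_opD !cpoly_opMX IH mulrDr mulrA; congr (_ + _).
by rewrite mulrC mul_polyC cpoly_opZ cpoly_opC -bop_scalerAr mulr1.
Qed.

Definition rpoly (r : {poly R}) : {poly R[i]} := map_poly (real_complex R) r.

Lemma poly_opE (r : {poly R}) T : poly_op r T = cpoly_op (rpoly r) T.
Proof.
rewrite /poly_op /cpoly_op /rpoly size_map_poly.
by apply: eq_bigr => i _; rewrite coef_map.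
Qed.

Implicit Types r s : {poly R}.

Lemma poly_opD r s T : poly_op (r + s) T = poly_op r T + poly_op s T.
Proof. by rewrite !poly_opE /rpoly rmorphD cpoly_opD. Qed.

Lemma poly_opM r s T : poly_op (r * s) T = poly_op r T * poly_op s T.
Proof. by rewrite !poly_opE /rpoly rmorphM cpoly_opM. Qed.

Lemma poly_opC (a : R) T : poly_op a%:P T = a%:C *: (1 : 'B(H)).
Proof. by rewrite !poly_opE /rpoly map_polyC cpoly_opC. Qed.

Lemma poly_opX T : poly_op 'X T = T.
Proof. by rewrite !poly_opE /rpoly map_polyX cpoly_opX. Qed.

Lemma poly_opZ (a : R) r T : poly_op (a *: r) T = a%:C *: poly_op r T.
Proof. by rewrite -mul_polyC poly_opM poly_opC -bop_scalerAl mul1r. Qed.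

Lemma poly_opN r T : poly_op (- r) T = - poly_op r T.
Proof. by rewrite -scaleN1r poly_opZ rmorphN1 scaleN1r. Qed.

Lemma poly_opB r s T : poly_op (r - s) T = poly_op r T - poly_op s T.
Proof. by rewrite poly_opD poly_opN. Qed.

Lemma poly_op_self_adjoint r T : self_adjoint T -> self_adjoint (poly_op r T).
Proof.
move=> sT; rewrite /poly_op.
have sX i : self_adjoint (T ^+ i).
  elim: i => [|i IH] x y; first exact: self_adjoint1.
  by rewrite {1}exprS exprSr !bopME sT IH.
apply: (big_ind (@self_adjoint R H)) => [|S U|i _].
- by move=> x y; rewrite !bop0E linear0l linear0r.
- exact: self_adjointD.
- exact: self_adjointZ.
Qed.

(** T is not bounded below, that is, 0 is in its approximate point spectrum.  Unlike
failure of invertibility, this passes to a factor of a product without any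
closed range argument. *)
Definition approx_singular T :=
  forall e : R, 0 < e -> exists x, rnorm (T x) < e * rnorm x.

Lemma approx_singularM S T : approx_singular (S * T) ->
  approx_singular S \/ approx_singular T.
Proof.
move=> nST; apply/or_asboolP; rewrite -implyNb; apply/implyP => /asboolPn.
move=> /existsNP[d /not_implyP[d0 /forallNP dS]]; apply/asboolP => e e0.
have [x xST] := nST (d * e) (mulr_gt0 d0 e0); exists x.
rewrite -(ltr_pM2l d0) mulrA; apply: le_lt_trans xST.
by rewrite bopME leNgt; apply/negP/dS.
Qed.

Lemma approx_singularZ a T : a != 0 -> approx_singular (a *: T) -> approx_singular T.
Proof.
move=> a0 nT e e0.
have a1 : 0 < complex.Re `|a|.
  by move: a0; rewrite -normr_gt0 ltcE => /andP[].
have [x xT] := nT _ (mulr_gt0 a1 e0); exists x.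
move: xT; rewrite bopZE /rnorm normrZ -{1}(RRe_real (normr_real a)) ReZ -mulrA.
by rewrite ltr_pM2l.
Qed.

Lemma approx_singular_root p T : p != 0 -> approx_singular (cpoly_op p T) ->
  exists2 z, root p z & approx_singular (T - z *: (1 : 'B(H))).
Proof.
move=> p0; have [rs pE] := closed_field_poly_normal p.
have lp0 : lead_coef p != 0 by rewrite lead_coef_eq0.
rewrite {1}pE cpoly_opZ => /(approx_singularZ lp0) prs.
have [z zrs sz] : exists2 z, z \in rs & approx_singular (T - z *: (1 : 'B(H))).
  elim: rs prs {pE} => [|z rs IH].
    rewrite big_nil cpoly_opC scale1r => /(_ 1 ltr01)[x].
    by rewrite bop1E mul1r ltxx.
  rewrite big_cons cpoly_opM => /approx_singularM[].
    rewrite cpoly_opD cpoly_opX -polyCN cpoly_opC scaleNr => sz.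
    by exists z => //; rewrite mem_head.
  by move=> /IH[w wrs sw]; exists w => //; rewrite in_cons wrs orbT.
by exists z => //; rewrite pE rootZ// root_prod_XsubC.
Qed.

Lemma approx_singular_spectrum T (t : R) :
  approx_singular (T - t%:C *: (1 : 'B(H))) -> spectrum T t%:C.
Proof.
move=> sT [S [Sinv _]]; have [k k0 Sk] := bop_norm_le S.
have [|x] := sT k^-1; first by rewrite invr_gt0.
rewrite -[T - _]opprB bopNE rnormN ltr_pdivlMl// => lt.
have := Sk ((t%:C *: (1 : 'B(H)) - T) x).
by rewrite -bopME Sinv bop1E leNgt lt.
Qed.

(** (T - z) x is the sum of the orthogonal vectors (T - Re z) x and - i (Im z) x,
so T - z is bounded below by |Im z|. *)
Lemma approx_singular_real T z : self_adjoint T -> approx_singular (T - z *: (1 : 'B(H))) ->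
  z = (complex.Re z)%:C.
Proof.
move=> sT sz; apply/eqP; rewrite eq_complex eqxx/=; apply/negPn/negP => b0.
have [|x] := sz `|complex.Im z|; first by rewrite normr_gt0.
pose S : 'B(H) := T - (complex.Re z)%:C *: (1 : 'B(H)).
have sS : self_adjoint S.
  exact/self_adjointD/self_adjointN/self_adjointZ.
pose b := - complex.Im z.
have -> : (T - z *: (1 : 'B(H))) x = S x + b%:C *: ('i *: x).
  rewrite !bopDE !bopNE !bopZE !bop1E -addrA; congr (_ + _).
  rewrite scalerA -!scaleNr -scalerDl; congr (_ *: _).
  by rewrite {1}[z]complexE opprD /b rmorphN mulNr mulrC.
have orth : rinner (S x) ('i *: x) = 0.
  have := inner_imag x (S x); rewrite -sS self_adjoint_real// rinnerC; lra.
rewrite -(ltr_pXn2r (n := 2)) ?nnegrE ?mulr_ge0 ?rnorm_ge0//.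
rewrite rnorm_sqrD rinnerZr orth rnormZ normrN !exprMn.
have -> : rnorm ('i *: x) = rnorm x.
  by rewrite /rnorm normrZ normc_def/= expr0n expr1n add0r sqrtr1 mul1r.
by rewrite !mulr0 addr0 ltNge lerDr sqr_ge0.
Qed.

(** For N the norm of S, ||(S^2 - N^2) x||^2 <= 2 N^2 (N^2 ||x||^2 - ||S x||^2),
which is small against ||x||^2 when x almost attains the norm of S. *)
Lemma opnorm_approx_singular S x0 : self_adjoint S -> x0 != 0 ->
  approx_singular (S * S - ((opnorm S) ^+ 2)%:C *: (1 : 'B(H))).
Proof.
move=> sS x00; set N := opnorm S => e e0.
have SN := @opnorm_norm_le _ _ S; rewrite -/N in SN.
have nx0 : 0 < rnorm x0 by rewrite lt_def rnorm_eq0 x00 rnorm_ge0.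
have N0 : 0 <= N.
  by have := le_trans (rnorm_ge0 _) (SN x0); rewrite pmulr_lge0.
have [N00|Nn0] := eqVneq N 0.
  exists x0; rewrite bopDE bopNE bopZE bopME N00 expr0n/= scale0r subr0.
  have Sx : S x0 = 0.
    apply/eqP; rewrite -rnorm_eq0 eq_le rnorm_ge0 andbT.
    by have := SN x0; rewrite N00 mul0r.
  by rewrite Sx linear0 rnorm0 mulr_gt0.
have Npos : 0 < N by rewrite lt_def Nn0.
pose h := Num.min N (e ^+ 2 / (4 * N ^+ 3)).
have h0 : 0 < h by rewrite lt_min Npos divr_gt0 ?exprn_gt0// mulr_gt0// exprn_gt0.
have hN : h <= N by rewrite ge_min lexx.
have he : 4 * N ^+ 3 * h <= e ^+ 2.
  rewrite -ler_pdivlMl ?mulr_gt0 ?exprn_gt0// mulrC.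
  by rewrite ge_min lexx orbT.
(* h is chosen so that 2 N^2 (N^2 - (N - h)^2) <= 4 N^3 h <= e^2 *)
have [x xS] : exists x, (N - h) * rnorm x < rnorm (S x).
  apply: contrapT => /forallNP no.
  suff : N <= N - h by lra.
  apply: opnorm_le; last by rewrite subr_ge0.
  by move=> x; rewrite leNgt; apply/negP/no.
exists x; rewrite bopDE bopNE bopZE bop1E bopME.
rewrite -(ltr_pXn2r (n := 2)) ?nnegrE ?mulr_ge0 ?rnorm_ge0 ?(ltW e0)//.
rewrite rnorm_sqrD rnormN rinnerNr rinnerZr rnormZ.
move/self_adjointP : sS => sS; rewrite sS rinnerxx ger0_norm ?sqr_ge0//.
have SS : rnorm (S (S x)) ^+ 2 <= N ^+ 2 * rnorm (S x) ^+ 2.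
  by rewrite -exprMn ler_pXn2r ?nnegrE ?mulr_ge0 ?rnorm_ge0.
have xS2 : (N - h) ^+ 2 * rnorm x ^+ 2 < rnorm (S x) ^+ 2.
  by rewrite -exprMn ltr_pXn2r ?nnegrE ?mulr_ge0 ?rnorm_ge0 ?subr_ge0.
rewrite !exprMn; move: SS xS2 (sqr_ge0 (rnorm x)).
move: (rnorm (S (S x)) ^+ 2) (rnorm (S x) ^+ 2) (rnorm x ^+ 2) => u w n SS xS2 n0.
have he' : 4 * N ^+ 3 * h * n <= e ^+ 2 * n by rewrite ler_wpM2r.
apply: lt_le_trans he'.
have N2 : 0 < N ^+ 2 by rewrite exprn_gt0.
have key : N ^+ 2 * ((N - h) ^+ 2 * n) < N ^+ 2 * w by rewrite ltr_pM2l.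
have hh : 0 <= N ^+ 2 * (h ^+ 2 * n) by rewrite mulr_ge0 ?(ltW N2)// mulr_ge0 ?sqr_ge0.
have hN3 : 0 <= N ^+ 3 * (h * n).
  by rewrite mulr_ge0 ?exprn_ge0// mulr_ge0// ltW.
lra.
Qed.

(** The half of the spectral mapping theorem that makes the functional calculus
well defined. *)
Lemma poly_op_norm_le r T (k : R) : self_adjoint T -> 0 <= k ->
  (forall t : R, spectrum T t%:C -> `|r.[t]| <= k) -> norm_le (poly_op r T) k.
Proof.
move=> sT k0 rk; apply: contrapT => nk.
set P := poly_op r T; set N := opnorm P.
have kN : k < N.
  rewrite ltNge; apply/negP => Nk; apply: nk.
  exact: norm_leW Nk (@opnorm_norm_le _ _ P).
have [x0 x00] : exists x0 : H, x0 != 0.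
  move/existsNP : nk => [x /negP]; rewrite -ltNge => kx; exists x.
  by apply: contraTneq kx => ->; rewrite linear0 rnorm0 mulr0 ltxx.
have real_root s : s != 0 -> approx_singular (poly_op s T) ->
    exists2 t : R, spectrum T t%:C & s.[t] = 0.
  rewrite -(map_poly_eq0 (real_complex R)) poly_opE => s0 /(approx_singular_root s0)[z].
  move=> sz Tz; have zR := approx_singular_real sT Tz.
  exists (complex.Re z); first by apply: approx_singular_spectrum; rewrite -zR.
  move: sz; rewrite zR /root horner_map/= => /eqP[]//.
have sq s : poly_op (s ^+ 2 - (opnorm (poly_op s T) ^+ 2)%:P) T =
    poly_op s T * poly_op s T - (opnorm (poly_op s T) ^+ 2)%:C *: (1 : 'B(H)).
  by rewrite poly_opB poly_opC expr2 poly_opM.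
have sing s : approx_singular (poly_op (s ^+ 2 - (opnorm (poly_op s T) ^+ 2)%:P) T).
  by rewrite sq; exact/(opnorm_approx_singular _ x00)/poly_op_self_adjoint.
have [t Tt rt] : exists2 t : R, spectrum T t%:C & (r ^+ 2 - (N ^+ 2)%:P).[t] = 0.
  (* if r^2 = N^2 then every spectral value will do, and X^2 - ||T||^2 has one *)
  have [q0|q0] := eqVneq (r ^+ 2 - (N ^+ 2)%:P) 0; last exact/(real_root _ q0)/sing.
  have [|t Tt _] := real_root _ _ (sing 'X); last by exists t => //; rewrite q0 horner0.
  apply/eqP => /(congr1 (fun s : {poly R} => s`_2)).
  by rewrite coefB coefXn coefC coef0 subr0 => /eqP; rewrite oner_eq0.
have := rk t Tt; rewrite leNgt => /negP; apply.
move: rt; rewrite !hornerE => /eqP; rewrite subr_eq0 => /eqP rt.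
rewrite -(ltr_pXn2r (n := 2)) ?nnegrE//.
by rewrite real_normK ?num_real// rt ltr_pXn2r ?nnegrE// (le_trans k0 (ltW kN)).
Qed.

End PolynomialCalculus.

(** * The continuous functional calculus *)

Section Calculus.
Context {R : realType} {H : hilbertType R}.
Implicit Types (x y : H) (S T U : 'B(H)) (f g : R -> R) (p q : {poly R}).

Lemma uniform_seqP (A : set R) (u : nat -> R -> R) f :
  {uniform A, u @ \oo --> f} <->
  forall e : R, 0 < e -> exists N, forall n, (N <= n)%N ->
    forall t, A t -> `|u n t - f t| < e.
Proof.
split=> [uf e e0|uf P].
  have [|N _ uN] := uf [set h | forall t, A t -> ball (f t) e (h t)].
    apply/uniform_nbhs; exists [set xy | ball xy.1 e xy.2]; split => //.
    exact: entourage_ball (PosNum e0).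
  exists N => n Nn t At; have := uN n Nn t At.
  by rewrite -ball_normE/= distrC.
move=> /uniform_nbhs[E [entE EP]].
move: entE; rewrite -entourage_ballE => -[e /= e0 eE].
have [N uN] := uf e e0; exists N => // n /= Nn; apply: EP => t At; apply: eE => /=.
by rewrite -ball_normE/= distrC; exact: uN.
Qed.

(** Equivalent to [is_cfc], with one polynomial for each precision in place of a
sequence; sums, products and limits are easier in this form. *)
Definition cfc_approx f T S := forall e : R, 0 < e -> exists p,
  (forall t : R, spectrum T t%:C -> `|p.[t] - f t| <= e) /\ norm_le (poly_op p T - S) e.

Lemma is_cfcP f T S : is_cfc f T S <-> cfc_approx f T S.
Proof.
split=> [[p [/uniform_seqP pf pS]] e e0|fS].
  have [N pN] := pf _ e0.
  have /cvgrPdist_lt/(_ _ e0)[M _ pM] := pS.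
  exists (p (maxn N M)); split.
    by move=> t Tt; apply/ltW/pN => //; exact: leq_maxl.
  apply: norm_leW (@opnorm_norm_le _ _ _).
  have := pM (maxn N M) (leq_maxr _ _); rewrite /= sub0r normrN => /ltW.
  by apply: le_trans; exact: ler_norm.
have inv0 n : 0 < (n.+1%:R : R)^-1 by rewrite invr_gt0 ltr0n.
have /choice[p pP] : forall n, exists p,
    (forall t : R, spectrum T t%:C -> `|p.[t] - f t| <= n.+1%:R^-1) /\
    norm_le (poly_op p T - S) n.+1%:R^-1 by move=> n; exact/fS/inv0.
have small (e : R) : 0 < e -> exists N, forall n, (N <= n)%N -> n.+1%:R^-1 < e.
  move=> e0; have [N _ eN] := near_infty_natSinv_lt (PosNum e0).
  by exists N => n; exact: eN.
exists p; split.
  apply/uniform_seqP => e e0; have [N eN] := small e e0.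
  by exists N => n Nn t Tt; apply: le_lt_trans (eN _ Nn); exact: (pP n).1.
apply/cvgrPdist_lt => e e0; have [N eN] := small e e0; exists N => // n Nn /=.
rewrite sub0r normrN ger0_norm ?opnorm_ge0//.
by apply: le_lt_trans (eN _ Nn); apply: opnorm_le (ltW (inv0 n)); exact: (pP n).2.
Qed.

Lemma cfc_approx_unique f T S S' : self_adjoint T ->
  cfc_approx f T S -> cfc_approx f T S' -> S = S'.
Proof.
move=> sT fS fS'; apply/eqP; rewrite -subr_eq0; apply/eqP/norm_le0 => e e0.
have e4 : 0 < e / 4 by rewrite divr_gt0.
have [p [pf pS]] := fS _ e4; have [q [qf qS]] := fS' _ e4.
have pq : norm_le (poly_op (p - q) T) (e / 4 + e / 4).
  apply: poly_op_norm_le => //; first by rewrite addr_ge0// ltW.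
  move=> t Tt; rewrite !hornerE.
  have -> : p.[t] - q.[t] = (p.[t] - f t) - (q.[t] - f t) by ring.
  by rewrite (le_trans (ler_normB _ _))// lerD ?pf ?qf.
have -> : S - S' = - (poly_op p T - S) + poly_op (p - q) T + (poly_op q T - S').
  by rewrite poly_opB opprB !addrA !subrK.
apply: (norm_leW (k := e / 4 + (e / 4 + e / 4) + e / 4)); first by lra.
by apply: norm_leD qS; apply: norm_leD pq; exact: norm_leN.
Qed.

Lemma cfcE f T S : self_adjoint T -> cfc_approx f T S -> cfc f T = S.
Proof.
move=> sT fS; apply: (cfc_approx_unique sT _ fS); apply/is_cfcP.
by apply: (@xgetPex _ 0 [set U | is_cfc f T U]); exists S; exact/is_cfcP.
Qed.

Lemma cfc_approx_ex f T : self_adjoint T ->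
  (forall e : R, 0 < e -> exists p, forall t : R, spectrum T t%:C -> `|p.[t] - f t| <= e) ->
  cfc_approx f T (cfc f T).
Proof.
move=> sT pf; suff [S fS] : exists S, cfc_approx f T S by rewrite (cfcE sT fS).
have inv0 n : 0 < (n.+1%:R : R)^-1 by rewrite invr_gt0 ltr0n.
have /choice[p pP] : forall n, exists p,
    forall t : R, spectrum T t%:C -> `|p.[t] - f t| <= n.+1%:R^-1.
  by move=> n; exact/pf/inv0.
have small (e : R) : 0 < e -> exists N, forall n, (N <= n)%N -> n.+1%:R^-1 < e.
  move=> e0; have [N _ eN] := near_infty_natSinv_lt (PosNum e0).
  by exists N => n; exact: eN.
have [|S pS] := @bop_complete _ _ (fun n => poly_op (p n) T).
  move=> e e0; have [|N eN] := small (e / 2); first by rewrite divr_gt0.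
  exists N => n m Nn Nm; rewrite -poly_opB; apply: poly_op_norm_le => //.
    exact: ltW.
  move=> t Tt; rewrite !hornerE.
  have -> : (p n).[t] - (p m).[t] = ((p n).[t] - f t) - ((p m).[t] - f t) by ring.
  rewrite (le_trans (ler_normB _ _))// (splitr e).
  by rewrite lerD// (le_trans (pP _ _ Tt))// ltW// eN.
exists S => e e0; have [N eN] := small e e0; have [M SM] := pS e e0.
exists (p (maxn N M)); split=> [t Tt|]; last exact/SM/leq_maxr.
by rewrite (le_trans (pP _ _ Tt))// ltW// eN// leq_maxl.
Qed.

Lemma cfc_approx_poly p T : cfc_approx (fun t => p.[t]) T (poly_op p T).
Proof.
move=> e e0; exists p; split => [t _|x]; first by rewrite subrr normr0 ltW.
by rewrite subrr bop0E rnorm0 mulr_ge0 ?rnorm_ge0// ltW.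
Qed.

Lemma cfc_approx_ext f g T S : (forall t : R, spectrum T t%:C -> f t = g t) ->
  cfc_approx f T S -> cfc_approx g T S.
Proof.
move=> fg fS e e0; have [p [pf pS]] := fS e e0.
by exists p; split => // t Tt; rewrite -fg// pf.
Qed.

Lemma cfc_approxD f g T S U : cfc_approx f T S -> cfc_approx g T U ->
  cfc_approx (fun t => f t + g t) T (S + U).
Proof.
move=> fS gU e e0; have e2 : 0 < e / 2 by rewrite divr_gt0.
have [p [pf pS]] := fS _ e2; have [q [qg qU]] := gU _ e2.
exists (p + q); split=> [t Tt|].
  by rewrite hornerD opprD addrACA (le_trans (ler_normD _ _))// (splitr e) lerD ?pf ?qg.
by rewrite poly_opD opprD addrACA (splitr e); exact: norm_leD.
Qed.

Lemma cfc_approxZ (a : R) f T S : cfc_approx f T S ->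
  cfc_approx (fun t => a * f t) T (a%:C *: S).
Proof.
move=> fS e e0; have a1 : 0 < `|a| + 1 by rewrite ltr_wpDl.
have [|p [pf pS]] := fS (e / (`|a| + 1)); first by rewrite divr_gt0.
have le_e : `|a| * (e / (`|a| + 1)) <= e.
  by rewrite mulrA ler_pdivrMr// mulrC ler_wpM2l ?ltW// ltrDl.
exists (a *: p); split=> [t Tt|].
  by rewrite hornerZ -mulrBr normrM (le_trans _ le_e)// ler_wpM2l// pf.
by rewrite poly_opZ -scalerBr; apply: norm_leW le_e _; exact: norm_leZ.
Qed.

Lemma cfc_approxM f g T S U (K L : R) :
  (forall t : R, spectrum T t%:C -> `|f t| <= K) ->
  (forall t : R, spectrum T t%:C -> `|g t| <= L) ->
  cfc_approx f T S -> cfc_approx g T U -> cfc_approx (fun t => f t * g t) T (S * U).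
Proof.
move=> fK gL fS gU e e0.
have [s s0 Ss] := bop_norm_le S; have [u u0 Uu] := bop_norm_le U.
pose C := 1 + s + u + `|K| + `|L|.
have C0 : 0 < C by rewrite /C; have := normr_ge0 K; have := normr_ge0 L; lra.
pose d := Num.min 1 (e / C).
have d0 : 0 < d by rewrite lt_min ltr01 divr_gt0.
have d1 : d <= 1 by rewrite ge_min lexx.
have dC : d * C <= e by rewrite -ler_pdivlMr// ge_min lexx orbT.
have [p [pf pS]] := fS _ d0; have [q [qg qU]] := gU _ d0.
exists (p * q); split=> [t Tt|].
  rewrite hornerM.
  have -> : p.[t] * q.[t] - f t * g t =
     (p.[t] - f t) * (q.[t] - g t) + (p.[t] - f t) * g t + f t * (q.[t] - g t) by ring.
  apply: (@le_trans _ _ (d * 1 + d * `|L| + `|K| * d)).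
    apply: (le_trans (ler_normD _ _)); apply: lerD.
      apply: (le_trans (ler_normD _ _)); rewrite !normrM.
      apply: lerD; apply: ler_pM => //; first exact: pf.
      - exact: le_trans (qg _ Tt) d1.
      - exact: pf.
      - exact: le_trans (gL _ Tt) (ler_norm _).
    rewrite normrM; apply: ler_pM => //; last exact: qg.
    exact: le_trans (fK _ Tt) (ler_norm _).
  apply: le_trans dC; rewrite /C.
  have ds : 0 < d * s by rewrite mulr_gt0.
  have du : 0 < d * u by rewrite mulr_gt0.
  lra.
rewrite poly_opM.
have -> : poly_op p T * poly_op q T - S * U = (poly_op p T - S) * (poly_op q T - U)
   + (poly_op p T - S) * U + S * (poly_op q T - U).
  by rewrite -mulrDr subrK mulrBl mulrBr addrA subrK.
apply: (norm_leW (k := d * 1 + d * u + s * d)).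
  apply: le_trans dC; rewrite /C.
  have ds : 0 <= d * `|K| by rewrite mulr_ge0 ?(ltW d0).
  have du : 0 <= d * `|L| by rewrite mulr_ge0 ?(ltW d0).
  lra.
apply: norm_leD; last by apply: norm_leM => //; exact: ltW.
apply: norm_leD; apply: norm_leM => //; try exact: ltW.
exact: norm_leW d1 qU.
Qed.

Lemma rinner_norm_le T (k : R) x : norm_le T k -> `|rinner (T x) x| <= k * rnorm x ^+ 2.
Proof.
move=> Tk; rewrite (le_trans (normr_rinner _ _))// expr2 mulrA.
by rewrite ler_wpM2r ?rnorm_ge0.
Qed.

Lemma cfc_approx_self_adjoint f T S : self_adjoint T -> cfc_approx f T S -> self_adjoint S.
Proof.
move=> sT fS; apply/self_adjointP => x y; apply/eqP; rewrite -subr_eq0 -normr_le0.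
apply/ler_addgt0Pl => e e0; rewrite addr0.
pose k := 2 * rnorm x * rnorm y + 1.
have k0 : 0 < k by rewrite /k ltr_wpDl// !mulr_ge0 ?rnorm_ge0.
have [|p [_ pS]] := fS (e / k); first by rewrite divr_gt0.
have /self_adjointP sp := @poly_op_self_adjoint _ _ p _ sT.
have -> : rinner (S x) y - rinner x (S y) =
    - rinner ((poly_op p T - S) x) y + rinner x ((poly_op p T - S) y).
  by rewrite !bopDE !bopNE rinnerDl rinnerDr rinnerNl rinnerNr sp; ring.
apply: (le_trans (ler_normD _ _)); rewrite normrN.
apply: (@le_trans _ _ (e / k * rnorm x * rnorm y + rnorm x * (e / k * rnorm y))).
  apply: lerD; apply: (le_trans (normr_rinner _ _)).
    by rewrite ler_wpM2r ?rnorm_ge0// pS.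
  by rewrite ler_wpM2l ?rnorm_ge0// pS.
apply: (@le_trans _ _ (e / k * k)); last by rewrite divfK// gt_eqF.
have : 0 < e / k by rewrite divr_gt0.
by move: (e / k) => d d0; rewrite /k; lra.
Qed.

(** A polynomial p that is e-close to f takes values in [- e, M] on the spectrum, with
M = |K| + e.  Then ||M - p(T)|| <= M + e, which gives <p(T) x, x> >= - e ||x||^2: no
square root of f is involved. *)
Lemma cfc_approx_ge0 f T S (K : R) : self_adjoint T ->
  (forall t : R, spectrum T t%:C -> 0 <= f t <= K) ->
  cfc_approx f T S -> positive_op S.
Proof.
move=> sT fK fS; apply/positive_opP; split; first exact: cfc_approx_self_adjoint fS.
move=> x; apply/ler_addgt0Pr => e e0.
pose d := e / (2 * (rnorm x ^+ 2 + 1)).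
have x0 : 0 < rnorm x ^+ 2 + 1 by rewrite ltr_wpDl ?sqr_ge0.
have d0 : 0 < d by rewrite divr_gt0// mulr_gt0.
have [p [pf pS]] := fS _ d0.
pose M := `|K| + d.
have : norm_le (poly_op (M%:P - p) T) (M + d).
  apply: poly_op_norm_le => //.
    by rewrite /M; have := normr_ge0 K; lra.
  move=> t Tt; rewrite !hornerE; have := pf _ Tt; have := fK _ Tt.
  have := ler_norm K; rewrite !ler_norml => KK /andP[f0 fKt] /andP[pf1 pf2].
  by rewrite /M; apply/andP; split; lra.
move=> /rinner_norm_le-/(_ x); have := rinner_norm_le x pS.
rewrite !ler_norml => /andP[_ le1] /andP[_ le2]; move: le1 le2.
rewrite poly_opB poly_opC !bopDE !bopNE bopZE bop1E !rinnerDl !rinnerNl rinnerZl rinnerxx.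
have de : 2 * (d * rnorm x ^+ 2) <= e.
  rewrite /d; move: (rnorm x ^+ 2) x0 (sqr_ge0 (rnorm x)) => n n0 n1.
  rewrite [e / _ * _]mulrAC mulrA ler_pdivrMr ?mulr_gt0//.
  by have : 0 <= e * n by [apply: mulr_ge0 => //; exact: ltW]; lra.
lra.
Qed.

End Calculus.

(** * Real powers of positive invertible operators *)

Section PositiveInvertible.
Context {R : realType} {H : hilbertType R}.
Implicit Types (x y : H) (S T : 'B(H)).

(** ||x||^2 <= ||T^-1||^2 ||T x||^2, and ||T x||^2 <= ||T|| <T x, x> since T is
positive. *)
Lemma Bpp_coercive T : Bpp H T ->
  exists2 d : R, 0 < d & forall x, d * rnorm x ^+ 2 <= rinner (T x) x.
Proof.
move=> [pT [S [ST _]]].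
have [c c0 Tc] := bop_norm_le T; have [k k0 Sk] := bop_norm_le S.
exists (c * k ^+ 2)^-1 => [|x]; first by rewrite invr_gt0 mulr_gt0// exprn_gt0.
rewrite ler_pdivrMl ?mulr_gt0 ?exprn_gt0//.
have Tx : rnorm (T x) ^+ 2 <= c * rinner (T x) x.
  apply: positive_op_sqr_le => // y.
  exact: le_trans (ler_norm _) (rinner_norm_le _ Tc).
have xT : rnorm x ^+ 2 <= k ^+ 2 * rnorm (T x) ^+ 2.
  rewrite -exprMn ler_pXn2r ?nnegrE ?mulr_ge0 ?rnorm_ge0 ?(ltW k0)//.
  by rewrite -{1}[x]bop1E -ST; exact: Sk.
apply: (le_trans xT); rewrite [leRHS]mulrAC [leRHS]mulrC.
by rewrite ler_wpM2l ?sqr_ge0.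
Qed.

Lemma Bpp_spectrum T : Bpp H T -> exists m M : R, [/\ 0 < m, m < M &
  forall t : R, spectrum T t%:C -> m <= t <= M].
Proof.
move=> BT; have [d d0 dT] := Bpp_coercive BT.
have [c c0 Tc] := bop_norm_le T; have [[sT _] _] := BT.
have sC (t : R) : self_adjoint (t%:C *: (1 : 'B(H)) - T).
  exact/self_adjointD/self_adjointN/sT/self_adjointZ.
exists d, (c + d); split => // [|t Tt]; first by rewrite ltrDr.
apply/andP; split; rewrite leNgt; apply/negP => lt; apply: Tt.
  rewrite -opprB; apply/invertibleN.
  apply: (@coercive_invertible _ _ _ (d - t)); rewrite ?subr_gt0//.
    by rewrite -opprB; apply: self_adjointN.
  move=> x; rewrite bopDE bopNE bopZE bop1E rinnerDl rinnerNl rinnerZl rinnerxx.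
  by rewrite mulrBl lerD2r.
apply: (@coercive_invertible _ _ _ (t - c)); rewrite ?subr_gt0//.
  by apply: lt_trans lt; rewrite ltrDl.
move=> x; rewrite bopDE bopNE bopZE bop1E rinnerDl rinnerNl rinnerZl rinnerxx.
rewrite mulrBl lerD2l lerN2.
exact: le_trans (ler_norm _) (rinner_norm_le _ Tc).
Qed.

Lemma op_powR_approx T (v : R) : Bpp H T -> cfc_approx (fun t => t `^ v) T (op_powR T v).
Proof.
move=> BT; have [m [M [m0 mM Tt]]] := Bpp_spectrum BT.
have [[sT _] _] := BT; apply: cfc_approx_ex => // e e0.
have [p pv] := powR_poly_approx v m0 mM e0.
by exists p => t /Tt; exact: pv.
Qed.

Lemma powR_spectrum_bounded T (v : R) : Bpp H T ->
  exists K : R, forall t : R, spectrum T t%:C -> `|t `^ v| <= K.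
Proof.
move=> BT; have [m [M [m0 mM Tt]]] := Bpp_spectrum BT.
have [L L0 vL] := powR_lipschitz v m0 mM.
exists (L * (M - m) + m `^ v) => t /Tt tmM.
have -> : t `^ v = (t `^ v - m `^ v) + m `^ v by ring.
apply: (le_trans (ler_normD _ _)); rewrite [`|m `^ v|]ger0_norm ?powR_ge0// lerD2r.
apply: (le_trans (vL _ _ tmM _)); first by rewrite lexx ltW.
move: tmM => /andP[mt tM]; rewrite ler_wpM2l ?(ltW L0)//.
by rewrite ger0_norm ?subr_ge0// lerD2r.
Qed.

Lemma op_powRD T (u v : R) : Bpp H T -> op_powR T u * op_powR T v = op_powR T (u + v).
Proof.
move=> BT; have [[sT _] _] := BT; symmetry; apply: cfcE => //.
have [m [M [m0 mM Tt]]] := Bpp_spectrum BT.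
have [K uK] := powR_spectrum_bounded u BT; have [L vL] := powR_spectrum_bounded v BT.
apply: cfc_approx_ext (cfc_approxM uK vL (op_powR_approx u BT) (op_powR_approx v BT)).
move=> t /Tt /andP[mt _]; rewrite powRD//; apply/implyP => _.
by rewrite gt_eqF// (lt_le_trans m0).
Qed.

Lemma op_powR0 T : Bpp H T -> op_powR T 0 = 1.
Proof.
move=> [[sT _] _]; apply: cfcE => //.
have -> : 1 = poly_op (1%:P : {poly R}) T by rewrite poly_opC scale1r.
by apply: cfc_approx_ext (cfc_approx_poly _ _) => t _; rewrite hornerC powRr0.
Qed.

Lemma op_powR1 T : Bpp H T -> op_powR T 1 = T.
Proof.
move=> BT; have [[sT _] _] := BT; apply: cfcE => //.
have [m [M [m0 mM Tt]]] := Bpp_spectrum BT.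
rewrite -{2}[T]poly_opX.
apply: cfc_approx_ext (cfc_approx_poly _ _) => t /Tt /andP[mt _].
by rewrite hornerX powRr1// (le_trans (ltW m0)).
Qed.

Lemma op_powR_self_adjoint T (v : R) : Bpp H T -> self_adjoint (op_powR T v).
Proof.
move=> BT; have [[sT _] _] := BT.
exact: cfc_approx_self_adjoint (op_powR_approx v BT).
Qed.

Lemma positive_op_conj S T : self_adjoint S -> positive_op T -> positive_op (S * T * S).
Proof.
move=> sS [sT pT]; split=> [x y|x]; first by rewrite !bopME sS sT sS.
by rewrite !bopME sS.
Qed.

End PositiveInvertible.

(** * Heinz means *)

Section HeinzMean.
Context {R : realType} {H : hilbertType R}.
Implicit Types (A B : 'B(H)) (s t u v : R).

(** Sum of the inequalities between u |-> t^u = exp (u ln t) and its tangent at y,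
taken at u = x and u = z. *)
Lemma powR_convex t x y z : 0 < t -> x <= y -> y <= z ->
  (z - x) * t `^ y <= (z - y) * t `^ x + (y - x) * t `^ z.
Proof.
move=> t0 xy yz.
have tangent u : t `^ y * (1 + (u - y) * ln t) <= t `^ u.
  rewrite -[X in _ <= t `^ X](subrKC y) powRD; last by apply/implyP => _; rewrite gt_eqF.
  rewrite ler_wpM2l ?powR_ge0//.
  by rewrite [t `^ _]/powR gt_eqF// expR_ge1Dx.
have := ler_wpM2l (_ : 0 <= z - y) (tangent x); rewrite subr_ge0 => /(_ yz).
have := ler_wpM2l (_ : 0 <= y - x) (tangent z); rewrite subr_ge0 => /(_ xy).
lra.
Qed.

Definition heinz_fun u t := 2^-1 * (t `^ u + t `^ (1 - u)).

Lemma heinz_fun_convex t x y z : 0 < t -> x <= y -> y <= z ->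
  (z - x) * heinz_fun y t <= (z - y) * heinz_fun x t + (y - x) * heinz_fun z t.
Proof.
move=> t0 xy yz; rewrite /heinz_fun.
have := powR_convex t0 xy yz.
have := @powR_convex t (1 - z) (1 - y) (1 - x) t0.
by rewrite !lerD2l !lerN2 => /(_ yz xy); lra.
Qed.

(** Convexity on v < 0 < s when v < 0, and on 0 < s < v when v > s. *)
Lemma heinz_fun_extrapolate t s v : 0 < t -> 0 < s -> v \notin `[0, s] ->
  heinz_fun 0 t <= heinz_fun v t + v / s * (heinz_fun 0 t - heinz_fun s t).
Proof.
move=> t0 s0; rewrite in_itv/= negb_and -!ltNge => vs.
rewrite -(ler_pM2l s0) mulrDr [s * (v / s * _)]mulrA [s * (v / s)]mulrC divfK ?gt_eqF//.
case/orP: vs => [v0|sv].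
  by have := heinz_fun_convex t0 (ltW v0) (ltW s0); lra.
by have := heinz_fun_convex t0 (ltW s0) (ltW sv); lra.
Qed.

(** The k-th term is 2^k (h 0 - h k) - 2^(k-1) (h 0 - h (k-1)). *)
Lemma telescope_sum (V : lmodType R[i]) (h : nat -> V) n :
  \sum_(1 <= k < n.+1) 2 ^+ k.-1 *: (h 0%N - 2 *: h k + h k.-1) =
  2 ^+ n *: (h 0%N - h n).
Proof.
elim: n => [|n IH]; first by rewrite big_nil subrr scaler0.
rewrite big_nat_recr//= IH -scalerDr exprSr -scalerA; congr (_ *: _).
by rewrite addrCA subrK addrAC scalerBr [2 *: h 0%N]scaler_nat mulr2n.
Qed.

Lemma heinzC v A B : heinz (1 - v) A B = heinz v A B.
Proof. by rewrite /heinz subKr addrC. Qed.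

Lemma Bpp_conj A B (S : 'B(H)) : self_adjoint S -> invertible S -> Bpp H B -> Bpp H (S * B * S).
Proof.
move=> sS iS [pB iB]; split; first exact: positive_op_conj.
by apply: invertibleM => //; exact: invertibleM.
Qed.

Section Transformed.
Context (A B : 'B(H)) (BA : Bpp H A) (BB : Bpp H B).

Let D := op_powR A 2^-1.
Let E := op_powR A (- 2^-1).
Let C := E * B * E.

Lemma half_powR_inv : D * E = 1 /\ E * D = 1.
Proof. by rewrite !op_powRD// subrr addNr op_powR0. Qed.

Lemma half_powR_sqr : D * D = A.
Proof. by rewrite op_powRD// -[RHS]op_powR1//; congr op_powR; field. Qed.

Lemma Bpp_transformed : Bpp H C.
Proof.
have [DE ED] := half_powR_inv.
apply: Bpp_conj => //; first exact: op_powR_self_adjoint.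
by exists D.
Qed.

Lemma wgmean0 : wgmean 0 A B = A.
Proof. by rewrite /wgmean (op_powR0 Bpp_transformed) mulr1 half_powR_sqr. Qed.

Lemma wgmean1 : wgmean 1 A B = B.
Proof.
have [DE ED] := half_powR_inv.
rewrite /wgmean (op_powR1 Bpp_transformed) -/D /C.
by rewrite !mulrA DE mul1r -mulrA ED mulr1.
Qed.

Lemma heinz0 : heinz 0 A B = amean A B.
Proof. by rewrite /heinz subr0 wgmean0 wgmean1. Qed.

(* heinz_fun u evaluated at C *)
Let G u : 'B(H) := (2^-1 : R)%:C *: (op_powR C u + op_powR C (1 - u)).

Lemma half_complex : (2^-1 : R[i]) = (2^-1 : R)%:C.
Proof. by rewrite fmorphV rmorph_nat. Qed.

Lemma heinz_conj u : heinz u A B = D * G u * D.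
Proof.
rewrite /heinz /G half_complex -bop_scalerAr -bop_scalerAl.
by rewrite mulrDr mulrDl.
Qed.

Lemma heinz_fun_approx u : cfc_approx (heinz_fun u) C (G u).
Proof.
by apply: cfc_approxZ; apply: cfc_approxD; exact: op_powR_approx Bpp_transformed.
Qed.

Lemma heinz_fun_bounded u :
  exists K : R, forall t : R, spectrum C t%:C -> `|heinz_fun u t| <= K.
Proof.
have [K uK] := powR_spectrum_bounded u Bpp_transformed.
have [L uL] := powR_spectrum_bounded (1 - u) Bpp_transformed.
exists (2^-1 * (K + L)) => t Ct; rewrite normrM ger0_norm// ler_wpM2l//.
by rewrite (le_trans (ler_normD _ _))// lerD ?uK ?uL.
Qed.

Lemma heinz_extrapolate s v : 0 < s -> v \notin `[0, s] ->
  op_le (amean A B) (heinz v A B + (v / s)%:C *: (amean A B - heinz s A B)).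
Proof.
move=> s0 vs; rewrite /op_le -heinz0 !heinz_conj.
have -> : D * G v * D + (v / s)%:C *: (D * G 0 * D - D * G s * D) - D * G 0 * D =
   D * (G v + (v / s)%:C *: (G 0 + (-1)%:C *: G s) + (-1)%:C *: G 0) * D.
  rewrite rmorphN1 !scaleN1r !mulrDr !mulrDl !mulrN !mulNr.
  by rewrite -bop_scalerAr -bop_scalerAl mulrBr mulrBl.
apply: positive_op_conj; first exact: op_powR_self_adjoint.
have approx := cfc_approxD (cfc_approxD (heinz_fun_approx v)
  (cfc_approxZ (v / s) (cfc_approxD (heinz_fun_approx 0) (cfc_approxZ (-1) (heinz_fun_approx s)))))
  (cfc_approxZ (-1) (heinz_fun_approx 0)).
have [m [M [m0 mM Ct]]] := Bpp_spectrum Bpp_transformed.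
have [K0 h0] := heinz_fun_bounded 0; have [Ks hs] := heinz_fun_bounded s.
have [Kv hv] := heinz_fun_bounded v.
have [[sC _] _] := Bpp_transformed.
apply: (cfc_approx_ge0 (K := Kv + `|v / s| * (K0 + Ks) + K0) sC _ approx) => t tC.
rewrite !mulN1r; apply/andP; split.
  have := @heinz_fun_extrapolate t s v; rewrite subr_ge0; apply => //.
  by have /andP[mt _] := Ct _ tC; exact: lt_le_trans mt.
have bnd (a b : R) : `|a| <= b -> - a <= b by apply: le_trans; rewrite -normrN ler_norm.
apply: lerD; last exact/bnd/h0.
apply: lerD; first exact: le_trans (ler_norm _) (hv _ tC).
rewrite (le_trans (ler_norm _))// normrM ler_wpM2l//.
by rewrite (le_trans (ler_normB _ _))// lerD ?h0 ?hs.
Qed.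

End Transformed.

Lemma heinz_refined A B n v : Bpp H A -> Bpp H B -> v \notin `[0, 1 / 2 ^+ n] ->
  op_le (amean A B)
    (heinz v A B + v%:C *: \sum_(1 <= k < n.+1) 2 ^+ k.-1 *:
        (amean A B - 2 *: heinz (1 / 2 ^+ k) A B
         + heinz (1 / 2 ^+ k.-1) A B)).
Proof.
move=> BA BB vn; have s0 : 0 < 1 / 2 ^+ n :> R by rewrite divr_gt0// exprn_gt0.
have h0 : amean A B = heinz (1 / 2 ^+ 0) A B.
  by rewrite expr0 divr1 -heinz0// -heinzC subr0.
have := heinz_extrapolate BA BB s0 vn.
rewrite {4}h0 (telescope_sum (fun k => heinz (1 / 2 ^+ k) A B)) -h0 scalerA.
congr (op_le _ (_ + _ *: _)).
by rewrite div1r invrK rmorphM/= rmorphXn/= rmorph_nat.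
Qed.

End HeinzMean.

Theorem corollary7 (R : realType) (H : hilbertType R) (A B : 'B(H))
    (n : nat) (v : R) :
  Bpp H A -> Bpp H B -> (1 <= n)%N ->
  (v \notin `[0, 1 / 2 ^+ n] ->
   op_le (amean A B)
     (heinz v A B + v%:C *: \sum_(1 <= k < n.+1) 2 ^+ k.-1 *:
        (amean A B - 2 *: heinz (1 / 2 ^+ k) A B
         + heinz (1 / 2 ^+ k.-1) A B)))
  /\
  (v \notin `[(2 ^+ n - 1) / 2 ^+ n, 1] ->
   op_le (amean A B)
     (heinz v A B + (1 - v)%:C *: \sum_(1 <= k < n.+1) 2 ^+ k.-1 *:
        (amean A B - 2 *: heinz ((2 ^+ k - 1) / 2 ^+ k) A B
         + heinz ((2 ^+ k.-1 - 1) / 2 ^+ k.-1) A B))).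
Proof.
move=> BA BB _; split; first exact: heinz_refined.
have compl k : (2 ^+ k - 1) / 2 ^+ k = 1 - 1 / 2 ^+ k :> R.
  by rewrite mulrBl divff// expf_neq0.
rewrite compl => vn; rewrite -(heinzC v).
under eq_bigr => k _ do rewrite !compl !heinzC.
apply: heinz_refined => //.
apply: contra vn; rewrite !in_itv/= => /andP[? ?]; apply/andP; split; lra.
Qed.
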